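(* For any graph $A$ it holds that $A \triangleright F(3,0)$ if and only if $A \longrightarrow F(3,0)$.
   Context: A graph has finite vertex and edge sets; every edge is either a normal edge (incident with two distinct vertices, adding 1 to the degree of each), a loop (incident with one vertex, adding 2 to its degree) or a semi-edge (incident with one vertex, adding 1 to its degree). Multiple loops, multiple semi-edges and parallel normal edges are allowed. A graph is simple if it has no loops, no semi-edges and no parallel normal edges. A covering projection from a graph $G$ to a connected graph $H$ is a pair of surjective maps $f_V:V(G)\to V(H)$, $f_E:E(G)\to E(H)$ such that $f_V$ preserves degrees; $f_E$ maps semi-edges onto semi-edges and loops onto loops (normal edges may be mapped onto normal edges, loops or semi-edges); $f_E$ preserves incidence (if $e$ is incident with $u,v$ then $f_E(e)$ is incident with $f_V(u),f_V(v)$); and $f_E$ is a local bijection between the edge-neighborhood of every vertex and that of its image. In particular, the preimage of a normal edge $uv$ is a perfect matching between $f_V^{-1}(u)$ and $f_V^{-1}(v)$, the preimage of a loop at $u$ is a disjoint union of cycles spanning $f_V^{-1}(u)$ (a loop is a cycle of length 1, two parallel edges a cycle of length 2), and the preimage of a semi-edge at $u$ is a disjoint union of semi-edges and normal edges spanning $f_V^{-1}(u)$ (each vertex of the fiber incident with exactly one of them). $G$ covers $H$, written $G\longrightarrow H$, if such a projection exists. $A \triangleright B$ (''$A$ is stronger than $B$'') means: every simple graph $G$ with $G\longrightarrow A$ also satisfies $G\longrightarrow B$. $F(a,b)$ denotes the one-vertex graph with $a$ semi-edges and $b$ loops. *)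

(* Defs.v *)
From HB Require Import structures.
From mathcomp Require Import all_boot.

Set Implicit Arguments.
Unset Strict Implicit.
Unset Printing Implicit Defensive.

Variant edge_kind := Normal | Loop | Semi.

Record graph := Graph {
  vert : finType;
  edge : finType;
  kind : edge -> edge_kind;
  ends : edge -> {set vert};
  card_ends : forall e, #|ends e| = if kind e is Normal then 2 else 1
}.

Definition is_loop (G : graph) (e : edge G) : bool :=
  if kind e is Loop then true else false.

Definition deg (G : graph) (v : vert G) : nat :=
  \sum_(e | v \in ends e) (if is_loop e then 2 else 1).

(* The edge-neighborhood of v, in which a loop counts twice, as it does in the
   degree: a loop e at v gives (e, false) and (e, true), any other edge e at v
   gives (e, false) only. Two normal edges at v may thus both lie over a single
   loop at the image of v. *)
Definition edge_nbh (G : graph) (v : vert G) : {set edge G * bool} :=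
  [set h : edge G * bool | (v \in ends h.1) && (h.2 ==> is_loop h.1)].

Definition simple_graph (G : graph) : Prop :=
  [/\ forall e : edge G, kind e <> Loop,
      forall e : edge G, kind e <> Semi
    & forall e1 e2 : edge G, kind e1 = Normal -> kind e2 = Normal ->
        ends e1 = ends e2 -> e1 = e2].

Definition adj (G : graph) : rel (vert G) :=
  fun u v => [exists e : edge G, (u \in ends e) && (v \in ends e)].

Definition connected_graph (G : graph) : Prop :=
  forall u v : vert G, connect (@adj G) u v.

(* The notion is only meant for connected H; connectedness of the target is
   left to the users of this definition. *)
Record covering_projection (G H : graph)
    (fV : vert G -> vert H) (fE : edge G -> edge H) : Prop := {
  cov_surjV : forall x : vert H, exists v, fV v = x;
  cov_surjE : forall a : edge H, exists e, fE e = a;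
  cov_deg : forall v, deg (fV v) = deg v;
  cov_semi : forall e, kind e = Semi -> kind (fE e) = Semi;
  cov_loop : forall e, kind e = Loop -> kind (fE e) = Loop;
  cov_ends : forall e, ends (fE e) = fV @: ends e;
  cov_local : forall v, exists phi : edge G * bool -> edge H * bool,
    [/\ {in edge_nbh v &, injective phi},
        phi @: edge_nbh v = edge_nbh (fV v)
      & {in edge_nbh v, forall h, (phi h).1 = fE h.1}]
}.

Definition covers (G H : graph) : Prop :=
  exists (fV : vert G -> vert H) (fE : edge G -> edge H),
    covering_projection fV fE.

Definition stronger (A B : graph) : Prop :=
  forall G : graph, simple_graph G -> covers G A -> covers G B.

Section OneVertex.
Variables a b : nat.

Definition F_kind (e : 'I_a + 'I_b) : edge_kind :=
  if e is inl _ then Semi else Loop.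

Definition F_ends (e : 'I_a + 'I_b) : {set unit} := [set tt].

Lemma F_card_ends e : #|F_ends e| = if F_kind e is Normal then 2 else 1.
Proof. by rewrite cards1; case: e. Qed.

Definition F : graph := Graph F_card_ends.

End OneVertex.

(* Main.v *)
Require Import Defs.
From mathcomp Require Import all_boot.

(* A cover of F(3,0) is a proper 3-edge-colouring of a cubic graph without
   loops, so it is enough to find a simple cover G of A such that every
   3-edge-colouring of G induces one of A. Take any simple cover K of A. For
   each edge e of a copy of A, cut e, cut one edge of a fresh copy of K lying
   over e, and reconnect the loose ends crosswise; semi-edges are cut open and
   joined to a second copy of A through K. By parity the two loose ends of K
   have the same colour in every 3-edge-colouring, so the two halves of e agree
   and the colouring restricts to the copy of A. The two halves of a loop would
   agree at a common vertex, so A has no loop. *)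

Set Implicit Arguments.
Unset Strict Implicit.
Unset Printing Implicit Defensive.

(** * Degrees and composition of coverings *)

Lemma ends_neq0 (G : graph) (e : edge G) : exists x, x \in ends e.
Proof. by apply/card_gt0P; rewrite card_ends; case: (kind e). Qed.

Lemma deg_card_edge_nbh (G : graph) (v : vert G) : deg v = #|edge_nbh v|.
Proof.
rewrite /deg -sum1_card.
rewrite (eq_bigl (fun h : edge G * bool =>
  (v \in ends h.1) && (h.2 ==> is_loop h.1))); last by move=> h; rewrite inE.
rewrite -(pair_big_dep (fun e => v \in ends e) (fun e b => b ==> is_loop e)
  (fun _ _ => 1)) /=.
apply: eq_bigr => e _; rewrite big_mkcond big_bool /=.
by case: (is_loop e).
Qed.

Lemma covers_trans (G A B : graph) : covers G A -> covers A B -> covers G B.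
Proof.
move=> [fV [fE f]] [gV [gE g]]; exists (gV \o fV), (gE \o fE); split.
- move=> x; have [y <-] := cov_surjV g x; have [z <-] := cov_surjV f y.
  by exists z.
- move=> x; have [y <-] := cov_surjE g x; have [z <-] := cov_surjE f y.
  by exists z.
- by move=> v; rewrite /= (cov_deg g) (cov_deg f).
- by move=> e /(cov_semi f) /(cov_semi g).
- by move=> e /(cov_loop f) /(cov_loop g).
- by move=> e; rewrite /= (cov_ends g) (cov_ends f) -imset_comp.
move=> v; have [p [pI pE pl]] := cov_local f v.
have [q [qI qE ql]] := cov_local g (fV v).
have pin h : h \in edge_nbh v -> p h \in edge_nbh (fV v).
  by move=> hv; rewrite -pE imset_f.
exists (q \o p); split.
- by move=> h k hv kv /qI eq_p; apply: pI => //; apply: eq_p; apply: pin.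
- by rewrite imset_comp pE.
- by move=> h hv; rewrite /= ql ?pin // pl.
Qed.

(** * Coverings of [F 3 0] from proper 3-edge-colourings *)

Lemma is_loopP (G : graph) (e : edge G) : reflect (kind e = Loop) (is_loop e).
Proof. by rewrite /is_loop; case: (kind e); constructor. Qed.

Lemma mem_edge_nbh_F30 h :
  (h \in edge_nbh (tt : vert (F 3 0))) = ~~ h.2.
Proof. by rewrite inE set11; case: h => [[i|[]//] []]. Qed.

Lemma card_edge_nbh_F30 : #|edge_nbh (tt : vert (F 3 0))| = 3.
Proof.
apply: etrans (card_ord 3); rewrite -(@card_imset _ _ (fun i : 'I_3 => (inl i : edge (F 3 0), false)));
  last by move=> i j [].
apply: eq_card => -[[i|[]//] b]; rewrite mem_edge_nbh_F30 /=.
case: b => /=; first by apply/esym/imsetP=> -[].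
by apply/esym/imsetP; exists i.
Qed.

(** The three colours name the three semi-edges. An injective colouring of three half-edges hits
    every colour, which gives the local bijection and, at [v0], surjectivity on edges. *)
Lemma covers_F30_of_coloring (A : graph) (v0 : vert A) (c : edge A -> 'I_3) :
    (forall e : edge A, kind e <> Loop) ->
    (forall v : vert A, #|edge_nbh v| = 3) ->
    (forall (v : vert A) e e', v \in ends e -> v \in ends e' -> c e = c e' -> e = e') ->
  covers A (F 3 0).
Proof.
move=> noloop cubic cinj.
have nbh_false (v : vert A) h : h \in edge_nbh v -> (v \in ends h.1) /\ h.2 = false.
  rewrite inE => /andP[-> ]; case: h.2 => //= /is_loopP.
  by move/noloop.
pose phi (h : edge A * bool) : edge (F 3 0) * bool := (inl (c h.1), false).
have phiI (v : vert A) : {in edge_nbh v &, injective phi}.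
  move=> [e b] [e' b'] /nbh_false[/= ev ->] /nbh_false[/= e'v ->] [].
  by move/(cinj _ _ _ ev e'v) ->.
have phiE (v : vert A) : phi @: edge_nbh v = edge_nbh (tt : vert (F 3 0)).
  apply/eqP; rewrite eqEcard card_in_imset // cubic card_edge_nbh_F30 leqnn andbT.
  by apply/subsetP=> _ /imsetP[h _ ->]; rewrite mem_edge_nbh_F30.
exists (fun=> tt), (fun e => inl (c e)); split.
- by case; exists v0.
- move=> [i|[]//]; have : (inl i, false) \in phi @: edge_nbh v0.
    by rewrite phiE mem_edge_nbh_F30.
  by case/imsetP=> h _ [->]; exists h.1.
- by move=> v; rewrite !deg_card_edge_nbh cubic card_edge_nbh_F30.
- by [].
- by move=> e /noloop.
- move=> e; have [x xe] := ends_neq0 e; apply/esym/eqP; rewrite eqEsubset; apply/andP; split.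
    by apply/subsetP=> -[] _; rewrite set11.
  by apply/subsetP=> -[] _; apply/imsetP; exists x.
- by move=> v; exists phi; split.
Qed.

(* The half-edges of the cover at w are the pairs (w, h) with h in the
   edge-neighborhood of the image of w; the edges are the orbits of dc_opp.
   Only the values of dc_opp on half-edges matter. *)
Record dart_cover (A : graph) := DartCover {
  dc_vert : finType;
  dc_proj : dc_vert -> vert A;
  dc_opp : dc_vert * (edge A * bool) -> dc_vert * (edge A * bool);
  dc_dart := fun d => d.2 \in edge_nbh (dc_proj d.1);
  dc_surj : forall v, exists w, dc_proj w = v;
  dc_opp_dart : forall d, dc_dart d -> dc_dart (dc_opp d);
  dc_oppK : forall d, dc_dart d -> dc_opp (dc_opp d) = d;
  dc_opp_edge : forall d, dc_dart d -> (dc_opp d).2.1 = d.2.1;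
  dc_ends : forall d, dc_dart d ->
    ends d.2.1 = [set dc_proj d.1; dc_proj (dc_opp d).1];
  dc_opp_neq : forall d, dc_dart d -> (dc_opp d).1 != d.1;
  dc_opp_inj : forall w h h', dc_dart (w, h) -> dc_dart (w, h') ->
    (dc_opp (w, h)).1 = (dc_opp (w, h')).1 -> h = h'
}.

(** * The simple graph of a dart cover, its covering of [A], its colourings *)

Section DartGraph.
Variables (A : graph) (D : dart_cover A).

Notation W := (dc_vert D).
Notation f := (@dc_proj A D).
Notation t := (@dc_opp A D).
Notation dart := (@dc_dart A D).

Definition dart_edge :=
  {S : {set W * (edge A * bool)} | [exists d, dart d && (S == [set d; t d])]}.

Definition dart_edge_kind (_ : dart_edge) := Normal.

Definition dart_edge_ends (S : dart_edge) : {set W} := fst @: val S.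

Lemma dart_edgeP (S : dart_edge) : exists2 d, dart d & val S = [set d; t d].
Proof. by case: S => S /= /existsP[d /andP[dd /eqP->]]; exists d. Qed.

Lemma dart_edge_mem (S : dart_edge) d :
  d \in val S -> dart d /\ val S = [set d; t d].
Proof.
have [x dx ->] := dart_edgeP S; rewrite !inE => /orP[]/eqP-> //.
by rewrite dc_opp_dart // dc_oppK // setUC.
Qed.

Lemma card_dart_edge_ends S :
  #|dart_edge_ends S| = if dart_edge_kind S is Normal then 2 else 1.
Proof.
rewrite /dart_edge_ends; have [d dd ->] := dart_edgeP S.
by rewrite imsetU1 imset_set1 cards2 eq_sym dc_opp_neq.
Qed.

Definition dart_graph : graph := 
  @Graph W dart_edge dart_edge_kind dart_edge_ends card_dart_edge_ends.

Lemma dart_edge_exists d : dart d -> exists S : dart_edge, val S = [set d; t d].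
Proof.
move=> dd; have Sd : [exists x, dart x && ([set d; t d] == [set x; t x])].
  by apply/existsP; exists d; rewrite dd eqxx.
by exists (exist (fun S => is_true [exists x, dart x && (S == [set x; t x])]) _ Sd).
Qed.

(** Parallel edges would give two half-edges at one vertex with the same opposite vertex, which
    [dc_opp_inj] excludes. *)
Lemma dart_graph_simple : simple_graph dart_graph.
Proof.
split=> // S1 S2 _ _ /= eqS; apply: val_inj => /=; move: eqS.
rewrite /dart_edge_ends; have [d dd E1] := dart_edgeP S1.
move=> eqS; have : d.1 \in fst @: val S2.
  by rewrite -eqS E1 imset_f // set21.
case/imsetP=> x /dart_edge_mem[dx E2] dx1.
rewrite E1 E2; suff -> : d = x by [].
have : (t d).1 \in fst @: val S2 by rewrite -eqS E1 imset_f // set22.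
rewrite E2 imsetU1 imset_set1 !inE -dx1 (negbTE (dc_opp_neq dd)) /=.
case: d x dd dx dx1 {E1 E2 eqS} => [w h] [w' h'] /= dd dx ww'; subst w' => /eqP.
by move/(dc_opp_inj dd dx) ->.
Qed.

Lemma dart_graph_nbh (w : W) (S : edge dart_graph) b :
  (S, b) \in edge_nbh (w : vert dart_graph) ->
  b = false /\ exists2 h, dart (w, h) & val S = [set (w, h); t (w, h)].
Proof.
rewrite inE /= => /andP[/imsetP[[w' h] /dart_edge_mem[dd E] /= ->]].
by case: b => //= _; split=> //; exists h.
Qed.

Lemma dart_graph_covering : exists fE : edge dart_graph -> edge A,
  covering_projection (f : vert dart_graph -> vert A) fE.
Proof.
have lab_exists (S : dart_edge) : exists e, [exists d in val S, d.2.1 == e].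
  have [d dd E] := dart_edgeP S; exists d.2.1.
  by apply/existsP; exists d; rewrite E set21 /=.
pose lab (S : edge dart_graph) : edge A := xchoose (lab_exists S).
have labE (S : dart_edge) d : d \in val S -> lab S = d.2.1.
  move=> /dart_edge_mem[dd E].
  have /existsP[x] := xchooseP (lab_exists S); rewrite -/(lab S) E !inE.
  by case/andP=> /orP[]/eqP-> /eqP <- //; rewrite dc_opp_edge.
have local (w : vert dart_graph) : exists phi : edge dart_graph * bool -> edge A * bool,
    [/\ {in edge_nbh w &, injective phi},
        phi @: edge_nbh w = edge_nbh (f w)
      & {in edge_nbh w, forall h, (phi h).1 = lab h.1}].
  (* By [dc_opp_neq] an edge at [w] has exactly one half-edge there, and [phi] reads off its label.
     Keeping the bit separates the two edges that lie over one loop. *)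
  pose phi (x : edge dart_graph * bool) :=
    odflt (lab x.1, false) [pick h | (w, h) \in val x.1].
  have phiE (S : dart_edge) b h : dart (w, h) -> val S = [set (w, h); t (w, h)] -> phi (S, b) = h.
    move=> dd E; rewrite /phi; case: pickP => /= [k|/(_ h)]; last by rewrite E set21.
    rewrite E !inE => /orP[/eqP[]//|/eqP tw].
    by move: (dc_opp_neq dd); rewrite -tw eqxx.
  exists phi; split.
  - move=> [S b] [S' b'] /dart_graph_nbh[-> [h dh E]] /dart_graph_nbh[-> [h' dh' E']].
    rewrite (phiE _ _ _ dh E) (phiE _ _ _ dh' E') => eqh; subst h'.
    by congr (_, _); apply: val_inj; rewrite /= E E'.
  - apply/setP=> h; apply/imsetP/idP => [[[S b] /dart_graph_nbh[_ [k dk E]] ->]|dh].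
      by rewrite (phiE _ _ _ dk E).
    have [S E] := dart_edge_exists (dh : dart (w, h)).
    exists (S, false); last by rewrite (phiE _ _ h).
    rewrite inE /= andbT; apply/imsetP; exists (w, h) => //.
    by rewrite E set21.
  - move=> [S b] /dart_graph_nbh[_ [h dh E]].
    by rewrite (phiE _ _ _ dh E) (@labE S (w, h)) // E set21.
exists lab; split => //.
- exact: dc_surj.
- move=> e; have [x xe] := ends_neq0 e; have [w wx] := dc_surj D x.
  have dd : dart (w, (e, false)) by rewrite /dc_dart inE /= wx xe.
  have [S E] := dart_edge_exists dd.
  by exists S; rewrite (@labE S (w, (e, false))) // E set21.
- move=> w; have [phi [pI pE _]] := local w.
  by rewrite !deg_card_edge_nbh -pE card_in_imset.
- move=> S; have [d dd E] := dart_edgeP S.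
  rewrite (@labE S d) ?E ?set21 // (dc_ends dd) /= /dart_edge_ends.
  by rewrite E !imsetU1 !imset_set1.
Qed.

Lemma dart_coloring : covers dart_graph (F 3 0) ->
  exists c : W * (edge A * bool) -> 'I_3,
  [/\ forall d, dart d -> c (t d) = c d,
      forall w, {in edge_nbh (f w) &, injective (fun h => c (w, h))}
    & forall w, #|edge_nbh (f w)| = 3].
Proof.
move=> [gV [gE g]].
(* The default of [col] is never reached, as [F 3 0] has no loop; that of [c] is not reached on
   half-edges, whose orbits are edges. *)
pose col (a : edge (F 3 0)) : 'I_3 := if a is inl i then i else ord0.
pose c d := if insub [set d; t d] is Some T then col (gE T) else ord0.
have cE (S : dart_edge) d : d \in val S -> c d = col (gE S).
  move=> /dart_edge_mem[_ E]; rewrite /c -E.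
  by rewrite valK.
exists c; split.
- move=> d dd; have [S E] := dart_edge_exists dd.
  by rewrite !(cE S) // E ?set21 ?set22.
- move=> w h k dh dk; have [S E] := dart_edge_exists (dh : dart (w, h)).
  have [S' E'] := dart_edge_exists (dk : dart (w, k)).
  rewrite (cE S) ?E ?set21 // (cE S') ?E' ?set21 // => eqc.
  have [phi [pI pE pl]] := cov_local g w.
  have in_nbh (X : dart_edge) l : val X = [set (w, l); t (w, l)] ->
      (X, false) \in edge_nbh (w : vert dart_graph).
    move=> EX; rewrite inE /= andbT; apply/imsetP; exists (w, l) => //.
    by rewrite EX set21.
  (* Every half-edge of [F 3 0] carries the bit [false], so [phi] is determined by [gE]. *)
  have phiE (X : dart_edge) l : val X = [set (w, l); t (w, l)] -> phi (X, false) = (gE X, false).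
    move=> EX; have Xin := in_nbh _ _ EX.
    have : phi (X, false) \in edge_nbh (gV w) by rewrite -pE imset_f.
    case: (gV w); rewrite mem_edge_nbh_F30; move: (pl _ Xin).
    by case: (phi _) => a [] //= ->.
  have eqS : S = S'.
    suff [//] : (S, false) = (S', false).
    apply: pI; [exact: in_nbh E|exact: in_nbh E'|].
    rewrite (phiE _ _ E) (phiE _ _ E'); congr (_, _).
    by move: eqc; case: (gE S) => [i|[]//]; case: (gE S') => [j|[]//] /= ->.
  have : (w, h) \in val S' by rewrite -eqS E set21.
  rewrite E' !inE => /orP[/eqP[]//|/eqP tw].
  by move: (dc_opp_neq (dk : dart (w, k))); rewrite -tw eqxx.
(* The dart graph covers both [A] and [F 3 0], so the degree 3 carries over to [A]. *)
- move=> w; have [fE fc] := dart_graph_covering.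
  rewrite -deg_card_edge_nbh (cov_deg fc w) -(cov_deg g) deg_card_edge_nbh.
  by case: (gV w); rewrite card_edge_nbh_F30.
Qed.

End DartGraph.

(** * A simple cover of [A] built around two copies of [A] *)

Section RootedCover.
Variable A : graph.

Notation H := (edge A * bool)%type.

Definition base (e : edge A) : vert A := xchoose (ends_neq0 e).

(** At a loop or semi-edge the default applies and the vertex is its own neighbour. *)
Definition other (e : edge A) (x : vert A) : vert A :=
  odflt x [pick y in ends e :\ x].

Lemma base_ends e : base e \in ends e.
Proof. exact: xchooseP (ends_neq0 e). Qed.

Lemma other_ends e x : x \in ends e -> ends e = [set x; other e x].
Proof.
move=> xe; rewrite /other; case: pickP => [y|none] /=.
  rewrite !inE => /andP[yx ye]; apply/esym/eqP.
  rewrite eqEcard subUset !sub1set xe ye cards2 eq_sym yx card_ends.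
  by case: (kind e).
apply/setP=> z; rewrite setUid inE; apply/idP/eqP => [ze|-> //].
by apply/eqP/negPn/negP=> zx; move: (none z); rewrite !inE zx ze.
Qed.

Lemma other_in e x : x \in ends e -> other e x \in ends e.
Proof. by move=> xe; rewrite (other_ends xe) set22. Qed.

Lemma otherK e x : x \in ends e -> other e (other e x) = x.
Proof.
move=> xe; have [eqx|neqx] := eqVneq (other e x) x; first by rewrite !eqx.
have := xe; rewrite {1}(other_ends (other_in xe)) !inE eq_sym (negbTE neqx) /=.
by move/eqP.
Qed.

Lemma other_neq e x : kind e = Normal -> x \in ends e -> other e x != x.
Proof.
move=> ke xe; have := card_ends e; rewrite ke (other_ends xe) cards2 eq_sym.
by case: eqP.
Qed.

Lemma other_id e x : kind e <> Normal -> x \in ends e -> other e x = x.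
Proof.
move=> ke xe; have := card_ends e; rewrite {1}(other_ends xe) cards2 eq_sym.
by case: (kind e) ke => //; case: eqP.
Qed.

Lemma ends_base e x : kind e <> Normal -> x \in ends e -> x = base e.
Proof.
by move=> ke; rewrite (other_ends (base_ends e)) other_id ?base_ends // !inE orbb => /eqP.
Qed.

(* The neighbour along h of a vertex of the simple cover of A on
   vert A * {set H}: each half-edge label toggles its own bit, so distinct
   labels give distinct neighbours, even for the two halves of a loop. *)
Definition flip (h : H) (w : vert A * {set H}) : vert A * {set H} :=
  (other h.1 w.1, if h \in w.2 then w.2 :\ h else h |: w.2).

Lemma mem_flip h k w : (k \in (flip h w).2) = (k == h) (+) (k \in w.2).
Proof.
rewrite /flip /=; case: ifP => hw; rewrite !inE; case: eqP => [->|] //=;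
  by rewrite hw.
Qed.

Lemma flipK h w : w.1 \in ends h.1 -> flip h (flip h w) = w.
Proof.
case: w => v X /= vh; congr (_, _); first exact: otherK.
by apply/setP=> k; rewrite !mem_flip /= addbA addbb.
Qed.

Lemma flip_label_inj h k w : (flip h w).2 = (flip k w).2 -> h = k.
Proof.
move=> eqf; have : (h \in (flip h w).2) = (h \in (flip k w).2) by rewrite eqf.
by rewrite !mem_flip eqxx; case: eqP => // _; case: (h \in w.2).
Qed.

Lemma flip_neq h w : flip h w != w.
Proof.
apply/eqP=> eqw; have := mem_flip h h w; rewrite eqw eqxx.
by case: (h \in w.2).
Qed.

(** The ends of the edge of K that is cut: the vertex [(base e, set0)] over [base e] and its
    neighbour along the label [(e, false)]. *)
Definition cut_end (e : edge A) (s : bool) : vert A * {set H} :=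
  if s then (other e (base e), [set (e, false)]) else (base e, set0).

Lemma flip_cut_end e s : flip (e, false) (cut_end e s) = cut_end e (~~ s).
Proof.
case: s; rewrite /flip /= ?otherK ?base_ends // !inE ?eqxx ?setDv //.
by rewrite setU0.
Qed.

Lemma cut_end_in e s : (cut_end e s).1 \in ends e.
Proof. by case: s; rewrite /= ?other_in ?base_ends. Qed.

Lemma cut_end_inj e : injective (cut_end e).
Proof.
have neq : [set (e, false)] <> set0 :> {set H}.
  by move/setP/(_ (e, false)); rewrite !inE eqxx.
by move=> [] [] // [_ eq0]; case: neq.
Qed.

(* Two copies of A, and for each edge e of A and each copy i a simple cover of
   A whose edge between cut_end e false and cut_end e true is cut. *)
Definition rvert : finType :=
  ((vert A * bool) + (edge A * bool) * (vert A * {set H}))%type.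

Definition rproj (w : rvert) : vert A :=
  match w with inl (x, _) => x | inr (_, (x, _)) => x end.

Definition rdart (d : rvert * H) := d.2 \in edge_nbh (rproj d.1).

Definition cut_dart e i s : rvert * H := (inr ((e, i), cut_end e s), (e, false)).

(* A semi-edge of A becomes a path from one copy of A to the other. *)
Definition attach (e : edge A) (i s : bool) : rvert * H :=
  match kind e with
  | Normal => (inl (if s then base e else other e (base e), i), (e, false))
  | Loop => (inl (base e, i), (e, s))
  | Semi => if s then cut_dart e (~~ i) true else (inl (base e, i), (e, false))
  end.

(** Inverse to [attach]: tells which loose end of its copy of K receives the half-edge [h] of a copy
    of A at [x]. *)
Definition side (x : vert A) (h : H) : bool :=
  match kind h.1 with Normal => x == base h.1 | Loop => h.2 | Semi => false end.

Definition ropp (d : rvert * H) : rvert * H :=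
  match d with
  | (inl (x, i), h) => cut_dart h.1 i (side x h)
  | (inr ((e, i), w), h) =>
      if h != (e, false) then (inr ((e, i), flip h w), h)
      else if w == cut_end e false then attach e i false
      else if w == cut_end e true then attach e i true
      else (inr ((e, i), flip h w), h)
  end.

Lemma ropp_cut_dart e i s : ropp (cut_dart e i s) = attach e i s.
Proof.
by rewrite /ropp /cut_dart eqxx !(inj_eq (@cut_end_inj e)); case: s.
Qed.

(** Reduces the nested tests of [ropp] inside a copy of K to two cases: a loose end, or an uncut
    edge. *)
Variant ropp_cover_spec e i w h : rvert * H -> rvert * H -> Prop :=
  | RoppCut s : w = cut_end e s -> h = (e, false) ->
      ropp_cover_spec e i w h (cut_dart e i s) (attach e i s)
  | RoppFlip : (forall s, (w, h) <> (cut_end e s, (e, false))) ->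
      ropp_cover_spec e i w h (inr ((e, i), w), h) (inr ((e, i), flip h w), h).

Lemma ropp_coverP e i w h :
  ropp_cover_spec e i w h (inr ((e, i), w), h) (ropp (inr ((e, i), w), h)).
Proof.
rewrite /ropp; case: eqP => [->|neqh]; last by constructor=> s [].
rewrite [~~ true]/=.
case: eqP => [->|n0]; first exact: RoppCut.
case: eqP => [->|n1]; first exact: RoppCut.
by constructor=> -[] [].
Qed.

Lemma cut_dart_dart e i s : rdart (cut_dart e i s).
Proof.
rewrite /rdart inE /= andbT; have := cut_end_in e s.
by case: (cut_end e s).
Qed.

Lemma attach_dart e i s : rdart (attach e i s).
Proof.
rewrite /attach; case ke: (kind e); last case: s.
- by rewrite /rdart inE /= andbT; case: s; rewrite ?other_in ?base_ends.
- by rewrite /rdart inE /= base_ends /is_loop ke implybT.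
- exact: cut_dart_dart.
- by rewrite /rdart inE /= base_ends.
Qed.

Lemma ropp_attach e i s : ropp (attach e i s) = cut_dart e i s.
Proof.
rewrite /attach; case ke: (kind e); last case: s.
- rewrite /= /side ke; case: s; rewrite ?eqxx //=.
  by rewrite (negbTE (other_neq ke (base_ends e))).
- by rewrite /= /side ke.
- by rewrite ropp_cut_dart /attach ke negbK.
- by rewrite /= /side ke.
Qed.

Lemma attach_side x i h :
  h \in edge_nbh x -> attach h.1 i (side x h) = (inl (x, i), h).
Proof.
case: h => e b; rewrite inE /attach /side /is_loop /= => /andP[xe].
case ke: (kind e) => bl.
- case: b bl => // _; congr (inl (_, _), _); case: eqP => // /eqP neqx.
  by move: xe; rewrite (other_ends (base_ends e)) !inE (negbTE neqx) => /eqP.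
- by rewrite (@ends_base e x) // ke.
- by case: b bl => // _; rewrite (@ends_base e x) // ke.
Qed.

(** This is why reconnection is crosswise: a loose end over one end of a normal edge is joined to a
    half-edge over the other, so the new edge still lies over [e]. *)
Lemma ends_attach e i s :
  ends e = [set (cut_end e s).1; rproj (attach e i s).1].
Proof.
have E := other_ends (base_ends e).
rewrite /attach; case ke: (kind e).
- by case: s => //=; rewrite setUC.
- by move: E; rewrite other_id ?ke ?base_ends // setUid => ->; case: s;
    rewrite /= ?other_id ?ke ?base_ends ?setUid.
- by move: E; rewrite other_id ?ke ?base_ends // setUid => ->; case: s;
    rewrite /= ?other_id ?ke ?base_ends ?setUid.
Qed.

Lemma attach_edge e i s : (attach e i s).2.1 = e.
Proof. by rewrite /attach; case: (kind e) => //; case: s. Qed.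

Lemma attach_neq e i s w : (attach e i s).1 != inr ((e, i), w).
Proof.
rewrite /attach; case: (kind e) => //; case: s => //.
(* At a semi-edge the loose end [true] is joined to the copy of K indexed by [~~ i], not back to its
   own. *)
by apply/eqP=> -[]; case: (i).
Qed.

Lemma rproj_surj v : exists w, rproj w = v.
Proof. by exists (inl (v, false)). Qed.

Lemma ropp_dart d : rdart d -> rdart (ropp d).
Proof.
case: d => [[[x i]|[[e i] w]] h]; first by move=> _; exact: cut_dart_dart.
case: ropp_coverP => [s _ _ _|_]; first exact: attach_dart.
rewrite /rdart; case: w => v X; rewrite !inE /= => /andP[vh ->].
by rewrite other_in.
Qed.

Lemma roppK d : rdart d -> ropp (ropp d) = d.
Proof.
case: d => [[[x i]|[[e i] w]] h].
  by move=> xh; rewrite ropp_cut_dart attach_side.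
case: ropp_coverP => [s _ _ _|nw dw]; first exact: ropp_attach.
have wh : w.1 \in ends h.1.
  by move: dw; rewrite /rdart inE /= => /andP[]; case: (w).
case: ropp_coverP => [s ws hs|_]; last by rewrite flipK.
(* If the flip arrived at loose end [s], it would have started at loose end [~~ s], against [nw]. *)
by case: (nw (~~ s)); rewrite -flip_cut_end -ws hs flipK // -hs.
Qed.

Lemma ropp_edge d : rdart d -> (ropp d).2.1 = d.2.1.
Proof.
case: d => [[[x i]|[[e i] w]] h] //.
by case: ropp_coverP => // s _ _ _; rewrite attach_edge.
Qed.

Lemma rproj_cut_dart e i s : rproj (cut_dart e i s).1 = (cut_end e s).1.
Proof. by rewrite /=; case: (cut_end e s). Qed.

Lemma ropp_ends d :
  rdart d -> ends d.2.1 = [set rproj d.1; rproj (ropp d).1].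
Proof.
case: d => [[[x i]|[[e i] w]] h] dd.
  by rewrite -[(_, h)](attach_side i dd) ropp_attach attach_edge rproj_cut_dart
    setUC -ends_attach.
move: dd; case: ropp_coverP => [s _ _ _|_].
  by rewrite rproj_cut_dart -ends_attach.
by rewrite /rdart inE; case: w => v X /= /andP[vh _]; exact: other_ends.
Qed.

Lemma ropp_neq d : rdart d -> (ropp d).1 != d.1.
Proof.
case: d => [[[x i]|[[e i] w]] h] // _.
case: ropp_coverP => [s _ _|_]; first exact: attach_neq.
by apply/eqP=> -[] /eqP; rewrite (negbTE (flip_neq h w)).
Qed.

(** From a copy of A, the vertex reached records the edge and the side, which determine the
    half-edge. Inside a copy of K distinct labels toggle distinct bits, and a half-edge at the cut
    leaves the copy. *)
Lemma ropp_inj w h k : rdart (w, h) -> rdart (w, k) ->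
  (ropp (w, h)).1 = (ropp (w, k)).1 -> h = k.
Proof.
case: w => [[x i]|[[e i] w]] dh dk.
  case: h k dh dk => [e b] [e' b'] dh dk [] eqe; subst e'.
  move/(@cut_end_inj e) => eqs.
  have := attach_side i dh; have := attach_side i dk.
  by rewrite eqs /= => -> [->].
case: (ropp_coverP e i w h) => [s _ ->|nh]; case: (ropp_coverP e i w k) => [s' _ ->|nk] //.
- by move/eqP; rewrite (negbTE (attach_neq _ _ _ _)).
- by move/esym/eqP; rewrite (negbTE (attach_neq _ _ _ _)).
- by case=> _; exact: (@flip_label_inj h k w).
Qed.

Definition rooted_cover : dart_cover A :=
  @DartCover A rvert rproj ropp rproj_surj ropp_dart roppK ropp_edge ropp_ends
    ropp_neq ropp_inj.

End RootedCover.

(** * Parity at the cuts and the induced colouring of [A] *)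

Section RootColoring.
Variables (A : graph) (c : rvert A * (edge A * bool) -> 'I_3).

Hypothesis cubic : forall v : vert A, #|edge_nbh v| = 3.
Hypothesis c_opp : forall d, rdart d -> c (ropp d) = c d.
Hypothesis c_inj :
  forall w : rvert A, {in edge_nbh (rproj w) &, injective (fun h => c (w, h))}.

Lemma color_exists (w : rvert A) a : exists2 h, h \in edge_nbh (rproj w) & c (w, h) = a.
Proof.
have : a \in (fun h => c (w, h)) @: edge_nbh (rproj w).
  suff -> : (fun h => c (w, h)) @: edge_nbh (rproj w) = setT by rewrite inE.
  by apply/eqP; rewrite eqEcard subsetT card_in_imset // cubic cardsT card_ord.
by case/imsetP=> h hw ->; exists h.
Qed.

(* Parity: the vertices of a simple cover of A come in pairs, and each has
   exactly one half-edge of colour a. The half-edges of colour a are paired up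
   by flip, except at the cut. *)
Lemma cut_color (e : edge A) i : c (cut_dart e i true) = c (cut_dart e i false).
Proof.
pose a := c (cut_dart e i false).
apply/eqP/negPn/negP => neq_a.
pose W' := (vert A * {set edge A * bool})%type.
pose cl (d : W' * (edge A * bool)) : rvert A * (edge A * bool) := (inr ((e, i), d.1), d.2).
(* The half-edges of colour [a] in this copy of K, exactly one at each vertex. *)
pose S := [set d | rdart (cl d) & c (cl d) == a].
have cardS : #|S| = #|{: W'}|.
  have <- : #|fst @: S| = #|{: W'}|.
    apply: eq_card => w; rewrite inE; apply/imsetP.
    have [h hw ca] := color_exists (inr ((e, i), w)) a.
    by exists (w, h); rewrite // inE /cl /= ca eqxx andbT.
  rewrite card_in_imset // => -[w h] [w' h']; rewrite !inE /=.
  move=> /andP[dh /eqP ch] /andP[dk /eqP ck] eqw; subst w'.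
  by congr (_, _); apply: (c_inj dh dk); rewrite ch.
pose d0 : W' * (edge A * bool) := (cut_end e false, (e, false)).
have d0S : d0 \in S by rewrite inE cut_dart_dart /=.
pose T := S :\ d0.
(* With [d0] removed, no loose end remains in [T], since the other one is not of colour [a]; hence
   [g] is an involution of [T]. *)
pose g (d : W' * (edge A * bool)) := (flip d.2 d.1, d.2).
have gT d : d \in T -> g d \in T /\ g (g d) = d.
  case: d => w h; rewrite !inE => /and3P[nd0 dd ca].
  have wh : w.1 \in ends h.1.
    by move: dd; rewrite /rdart inE /cl /= => /andP[]; case: (w).
  split; last by rewrite /g /= flipK.
  have {}dd : rdart (inr ((e, i), w), h) := dd.
  have := c_opp dd; have := ropp_dart dd.
  have : c (inr ((e, i), w), h) == a := ca.
  case: ropp_coverP => [s ws hs|nw ca' dd' eqc].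
    case: s ws => ws; last by rewrite ws hs eqxx in nd0.
    by rewrite (negbTE neq_a).
  rewrite eqc (eqP ca') eqxx andbT dd' andbT.
  apply/eqP=> gd0; have E2 : h = (e, false) := congr1 snd gd0.
  have E1 : flip h w = cut_end e false := congr1 fst gd0.
  by case: (nw true); rewrite -[cut_end e true](flip_cut_end e false) -E1 -E2 flipK.
(* [g] toggles the bit of the label, so it exchanges the two halves of [T] cut out by [P]. Thus [T]
   is even and [S] is odd. *)
pose P := [set d : W' * (edge A * bool) | d.2 \in d.1.2].
have cardT : #|T :&: P| = #|T :\: P|.
  have <- : g @: (T :&: P) = T :\: P.
    apply/setP=> d; apply/imsetP/idP => [[x /setIP[xT]]|/setDP[dT]].
      rewrite inE => xP ->; rewrite inE (proj1 (gT _ xT)) andbT.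
      by rewrite inE /= mem_flip eqxx xP.
    rewrite inE => dP; exists (g d); last by rewrite (proj2 (gT _ dT)).
    by rewrite inE (proj1 (gT _ dT)) inE /= mem_flip eqxx.
  rewrite card_in_imset // => x y /setIP[xT _] /setIP[yT _] eqg.
  by rewrite -(proj2 (gT _ xT)) eqg (proj2 (gT _ yT)).
have oddS : odd #|S|.
  by rewrite (cardsD1 d0) d0S -/T -(cardsID P T) cardT addnn /= odd_double.
(* The number of subsets of half-edge labels is a power of 2 with positive exponent, because [e]
   exists. *)
have evenW : ~~ odd #|{: W'}|.
  have cardX : #|{: {set edge A * bool}}| = 2 ^ (#|edge A| * 2).
    by rewrite -[LHS]cardsT -powersetT card_powerset cardsT card_prod card_bool.
  rewrite card_prod cardX.
  have : 0 < #|edge A| by apply/card_gt0P; exists e.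
  by rewrite oddM oddX muln_eq0 lt0n !orbF => /negbTE ->; rewrite andbF.
by move: oddS; rewrite cardS (negbTE evenW).
Qed.

(** Transfers the parity result across the reconnected edges to the half-edges joined to the loose
    ends. *)
Lemma attach_color (e : edge A) i : c (attach e i true) = c (attach e i false).
Proof.
have col s : c (attach e i s) = c (cut_dart e i s).
  by rewrite -ropp_cut_dart c_opp ?cut_dart_dart.
by rewrite !col cut_color.
Qed.

Lemma rooted_no_loop (e : edge A) : kind e <> Loop.
Proof.
move=> ke; have := attach_color e false; rewrite /attach ke => eqc.
suff : (e, true) = (e, false) by [].
by apply: (c_inj _ _ eqc); rewrite inE /= base_ends /is_loop ?ke.
Qed.

(** Makes the colour of an edge in the copy [false] of A independent of the end at which it is
    read. *)
Lemma root_color (e : edge A) x :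
  x \in ends e -> c (inl (x, false), (e, false)) = c (inl (base e, false), (e, false)).
Proof.
move=> xe; case ke: (kind e); last 2 first.
- by rewrite (@ends_base _ e x) // ke.
- by rewrite (@ends_base _ e x) // ke.
have := attach_color e false; rewrite /attach ke => eqc.
by move: xe; rewrite (other_ends (base_ends e)) !inE => /orP[]/eqP->.
Qed.

Lemma covers_F30_of_root_coloring : vert A -> covers A (F 3 0).
Proof.
move=> v0; pose col e := c (inl (base e, false), (e, false)).
apply: (@covers_F30_of_coloring A v0 col rooted_no_loop cubic).
move=> v e e' ve ve'; rewrite /col -(root_color ve) -(root_color ve') => eqc.
suff [] : (e, false) = (e', false) by [].
by apply: (c_inj _ _ eqc); rewrite inE /= ?ve ?ve'.
Qed.

End RootColoring.

Theorem theorem5 (A : graph) (A_connected : connected_graph A) :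
  stronger A (F 3 0) <-> covers A (F 3 0).
Proof.
split=> [strong|covA G _ covG]; last exact: covers_trans covG covA.
have [fE f] := dart_graph_covering (rooted_cover A).
have covG : covers (dart_graph (rooted_cover A)) A by exists (@rproj A), fE.
have covF := strong _ (dart_graph_simple (rooted_cover A)) covG.
have [c [c_opp c_inj card3]] := dart_coloring covF.
(* Surjectivity onto [tt] supplies a vertex of the cover, hence one of [A]. *)
have [gV [gE g]] := covF; have [w0 _] := cov_surjV g tt.
apply: (covers_F30_of_root_coloring (c := c)) (rproj w0) => // v.
by have [w <-] := rproj_surj v; exact: card3.
Qed.
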